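(* Let $T \ge 0$ be a real number and let $\varepsilon_1,\ldots,\varepsilon_n$ be independent Rademacher random variables. Consider any discarding algorithm (online or not), i.e. any function that maps each sign string $(\varepsilon_1,\dots,\varepsilon_n) \in \{-1,1\}^n$ to a subset of $\{1,\dots,n\}$ of terms to be discarded (the remaining indices being accepted), that maintains, for each $k \in \{1,\dots,n\}$, $$\Bigl| \sum_{j \le k,\ j \text{ accepted}} \varepsilon_j \Bigr| \le T \quad \text{deterministically}.$$ Then $$\mathbb{E}\,\#\{\text{discarded}\} \ge \frac{n}{2T+1} - T .$$
   Context: A Rademacher random variable takes the values $+1$ and $-1$ with probability $1/2$ each. ''Deterministically'' means for every sign string in $\{-1,1\}^n$. $\#\{\text{discarded}\}$ is the cardinality of the set of discarded indices, and the expectation is over the random signs. *)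

(* Defs.v *)
From HB Require Import structures.
From mathcomp Require Import all_boot all_order all_algebra.
From mathcomp Require Import all_classical all_reals all_analysis.

Set Implicit Arguments.
Unset Strict Implicit.
Unset Printing Implicit Defensive.

Import Order.TTheory GRing.Theory Num.Theory.
Import numFieldNormedType.Exports.

Local Open Scope classical_set_scope.
Local Open Scope ring_scope.

Definition rademacher d (Omega : measurableType d) (R : realType)
    (P : probability Omega R) (X : {RV P >-> R}) : Prop :=
  P (X @^-1` [set 1]) = (2^-1)%:E /\ P (X @^-1` [set -1]) = (2^-1)%:E.

Definition mutually_independent d (Omega : measurableType d) (R : realType)
    (P : probability Omega R) (I : finType) (X : I -> {RV P >-> R}) : Prop :=
  forall (J : {set I}) (B : I -> set R),
    (forall i, i \in J -> measurable (B i)) ->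
    P (\bigcap_(i in [set i | i \in J]) (X i @^-1` B i)) =
    (\prod_(i in J) P (X i @^-1` B i))%E.

(* [s j = false] encodes the sign [+1] and [s j = true] the sign [-1],
   i.e. the [j]-th sign is [(-1) ^+ s j]. *)
Definition sign_string (n : nat) := {ffun 'I_n -> bool}.

(* Maps a sign string to the set of its discarded indices. *)
Definition discarding_algorithm (n : nat) := sign_string n -> {set 'I_n}.

Definition maintains (R : realType) (n : nat) (T : R)
    (A : discarding_algorithm n) : Prop :=
  forall (s : sign_string n) (k : 'I_n),
    `| \sum_(j < n | (j <= k)%N && (j \notin A s)) (-1) ^+ s j | <= T.

(* For Rademacher variables, [(-1) ^+ signs eps w j = eps j w] almost surely. *)
Definition signs (Omega : Type) (R : realType) (n : nat)
    (eps : 'I_n -> Omega -> R) (w : Omega) : sign_string n :=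
  [ffun j => eps j w < 0].

(* Main.v *)
Require Import Defs.
From HB Require Import structures.
From mathcomp Require Import all_boot all_order all_algebra.
From mathcomp Require Import all_classical all_reals all_analysis.
From mathcomp Require Import measurable_realfun.
From mathcomp Require Import zify ring lra.

Set Implicit Arguments.
Unset Strict Implicit.
Unset Printing Implicit Defensive.

Import Order.TTheory GRing.Theory Num.Theory.
Import numFieldNormedType.Exports.

Local Open Scope classical_set_scope.
Local Open Scope ring_scope.

(** Write [t] for the integer part of [T] and shift the accepted partial sums by
    [t]: they form a walk in the strip [{0, ..., 2t}] that starts at [t] and
    stays put whenever a sign is discarded.  Compare it with the greedy walk
    driven by the same signs, which skips a sign only when it would leave the
    strip.

    Greedy is optimal, up to its starting point: on every sign string, the
    number of skips of the greedy walk, plus its distance to any competing walk,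
    grows no faster than the number of discards of the competitor
    ([clipped_walk_optimal]).  When only the greedy walk skips, the competitor
    takes a unit step towards it; when only the competitor discards, the
    distance grows by at most one.  So a greedy walk started anywhere in the
    strip skips at most [t] signs more than the given algorithm discards.

    Now start the greedy walk uniformly on the [2t + 1] points of the strip.  The
    uniform law is stationary ([clipped_walk_uniform]), and under it a sign is
    skipped with probability [1 / (2t + 1)]: only the two end points can skip,
    each for one of the two signs.  The expected number of skips is therefore
    [n / (2t + 1)], the algorithm discards at least [n / (2t + 1) - t] signs on
    average, and this is at least [n / (2T + 1) - T] because [t <= T].

    The averages are computed by counting over all sign strings; the probability
    space enters only through the fact that each sign string has probability at
    least [2^-n]. *)

(** * The greedy walk in a strip *)

Definition clip_step (M : nat) (b : bool) (y : nat) : nat :=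
  if b then y.-1 else minn y.+1 M.

Definition overflow (M : nat) (b : bool) (y : nat) : bool :=
  if b then y == 0%N else y == M.

Fixpoint clipped_walk (M : nat) (b : nat -> bool) (y0 k : nat) : nat :=
  if k is k'.+1 then clip_step M (b k') (clipped_walk M b y0 k') else y0.

Lemma clipped_walk_le (M : nat) (b : nat -> bool) (y0 k : nat) :
  (y0 <= M)%N -> (clipped_walk M b y0 k <= M)%N.
Proof. by move=> y0M; elim: k => //= k; rewrite /clip_step; case: (b k); lia. Qed.

(** The left-hand side is a potential that grows by at most one per discard of
    the competing walk [x] and does not grow otherwise.  The only case that adds
    a skip without a discard has the greedy walk at an end point and [x], which
    must stay in the strip, moving one step towards that end point. *)
Lemma clipped_walk_optimal (M : nat) (b acc : nat -> bool) (x : nat -> int)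
    (y0 n : nat) :
  (y0 <= M)%N ->
  (forall k, (k <= n)%N -> 0 <= x k <= M%:Z) ->
  (forall k, (k < n)%N -> x k.+1 = x k + (if acc k then (-1) ^+ b k else 0)) ->
  (\sum_(k < n) overflow M (b k) (clipped_walk M b y0 k)
     + `|x n - (clipped_walk M b y0 n)%:Z|
   <= \sum_(k < n) ~~ acc k + `|x 0%N - y0%:Z|)%N.
Proof.
move=> y0M; elim: n => [|n IHn] x_in x_step; first by rewrite !big_ord0.
have {IHn} := IHn (fun k kn => x_in k (leqW kn)) (fun k kn => x_step k (leqW kn)).
rewrite !big_ord_recr /= (x_step n (ltnSn n)).
have := x_in n (leqnSn n); have := x_in n.+1 (leqnn _).
rewrite (x_step n (ltnSn n)).
move: (clipped_walk_le b n y0M).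
set y := clipped_walk _ _ _ _.
set S := (\sum_(_ < _) _)%N; set S' := (\sum_(_ < _) _)%N.
rewrite /overflow /clip_step.
case: (b n); case: (acc n); rewrite /= ?expr1 ?expr0; lia.
Qed.

(** This is stationarity of the uniform measure: each point of the strip is
    reached by exactly two of the [2 (M + 1)] transitions, because at an end
    point a skip stands in for the step from the missing neighbour. *)
Lemma sum_clip_step (M : nat) (f : nat -> nat) :
  (\sum_(y < M.+1) (f (clip_step M true y) + f (clip_step M false y))
   = 2 * \sum_(y < M.+1) f y)%N.
Proof.
rewrite big_split /= big_ord_recl [X in (_ + X)%N]big_ord_recr /=.
rewrite (minn_idPr (leqnSn M)).
under [X in (_ + (X + _))%N]eq_bigr => i _ do
  rewrite (minn_idPl (ltn_ord i)).
have recr : (\sum_(y < M.+1) f y = \sum_(y < M) f y + f M)%N.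
  by rewrite big_ord_recr.
have recl : (\sum_(y < M.+1) f y = f 0 + \sum_(y < M) f y.+1)%N.
  by rewrite big_ord_recl.
rewrite mul2n -addnn {1}recl recr /bump /=.
by rewrite -!addnA; congr addn; rewrite addnCA.
Qed.

Lemma sum_overflow (M : nat) :
  (\sum_(y < M.+1) (overflow M true y + overflow M false y) = 2)%N.
Proof.
rewrite big_split /= big_ord_recl big1 // [X in (_ + X)%N]big_ord_recr /= big1.
  by rewrite eqxx.
by move=> i _; rewrite /= ltn_eqF.
Qed.

(** * Averaging over sign strings and starting points *)

(** The walk reads signs along [nat]; a sign string is padded with [false]. *)
Definition sign_at (n : nat) (s : sign_string n) (k : nat) : bool :=
  oapp s false (insub k).

Lemma sign_at_ord (n : nat) (s : sign_string n) (j : 'I_n) :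
  sign_at s j = s j.
Proof. by rewrite /sign_at valK. Qed.

Definition flip (n : nat) (j : 'I_n) (s : sign_string n) : sign_string n :=
  [ffun i => (i == j) (+) s i].

Lemma flipK (n : nat) (j : 'I_n) : involutive (flip j).
Proof. by move=> s; apply/ffunP => i; rewrite !ffunE addKb. Qed.

Lemma clipped_walk_flip (n M : nat) (j : 'I_n) (s : sign_string n)
    (y0 k : nat) : (k <= j)%N ->
  clipped_walk M (sign_at (flip j s)) y0 k = clipped_walk M (sign_at s) y0 k.
Proof.
elim: k => //= k IHk kj; rewrite IHk 1?ltnW //; congr (clip_step _ _ _).
have kn : (k < n)%N := ltn_trans kj (ltn_ord j).
have -> : k = Ordinal kn by [].
by rewrite !sign_at_ord ffunE -val_eqE /= ltn_eqF.
Qed.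

(** Independence of the [j]-th sign from the position at time [j], which depends
    on the earlier signs only: flipping the [j]-th sign is an involution of the
    sign strings that leaves this position unchanged. *)
Lemma sum_next_sign (n M : nat) (j : 'I_n) (y0 : nat)
    (h : bool -> nat -> nat) :
  (2 * \sum_(s : sign_string n) h (s j) (clipped_walk M (sign_at s) y0 j)
   = \sum_(s : sign_string n)
       (h true (clipped_walk M (sign_at s) y0 j)
        + h false (clipped_walk M (sign_at s) y0 j)))%N.
Proof.
rewrite mul2n -addnn {2}(reindex_inj (inv_inj (flipK j))) -big_split /=.
apply: eq_bigr => s _; rewrite clipped_walk_flip // ffunE eqxx /=.
by case: (s j) => //=; rewrite addnC.
Qed.

(** Started uniformly, the greedy walk is uniform at every time; the test
    function [f] makes the induction on [k] go through, since one step of the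
    walk only replaces it with another one. *)
Lemma clipped_walk_uniform (n M k : nat) (f : nat -> nat) : (k <= n)%N ->
  (\sum_(y0 < M.+1) \sum_(s : sign_string n)
      f (clipped_walk M (sign_at s) y0 k)
   = 2 ^ n * \sum_(y < M.+1) f y)%N.
Proof.
elim: k f => [|k IHk] f kn /=.
  rewrite big_distrr; apply: eq_bigr => y _.
  by rewrite /= sum_nat_const card_ffun card_bool card_ord.
apply/eqP; rewrite -(eqn_pmul2l (m := 2)) // mulnCA -sum_clip_step; apply/eqP.
rewrite -(IHk (fun y => f (clip_step M true y) + f (clip_step M false y))%N) 1?ltnW //.
rewrite big_distrr; apply: eq_bigr => y0 _ /=.
rewrite -(sum_next_sign M (Ordinal kn) y0 (fun b y => f (clip_step M b y))).
congr (2 * _)%N; apply: eq_bigr => s _.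
by rewrite -(sign_at_ord s (Ordinal kn)).
Qed.

(** At each of the [n] times, the position is uniform and two of the [2 (M + 1)]
    pairs of a sign and a position cause a skip. *)
Lemma sum_overflow_clipped_walk (n M : nat) :
  (\sum_(y0 < M.+1) \sum_(s : sign_string n) \sum_(k < n)
      overflow M (sign_at s k) (clipped_walk M (sign_at s) y0 k)
   = n * 2 ^ n)%N.
Proof.
under eq_bigr do rewrite exchange_big.
rewrite exchange_big -[X in _ = (X * _)%N](card_ord n) -sum_nat_const; apply: eq_bigr => j _ /=.
apply/eqP; rewrite -(eqn_pmul2l (m := 2)) // big_distrr /=; apply/eqP.
under eq_bigr => y0 _.
  under eq_bigr do rewrite sign_at_ord.
  rewrite (sum_next_sign M j y0 (fun b y => nat_of_bool (overflow M b y))).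
over.
rewrite (clipped_walk_uniform _ (fun y => overflow M true y + overflow M false y)%N) 1?ltnW //.
by rewrite sum_overflow mulnC.
Qed.

(** * From the discarding algorithm to the greedy walk *)

(** The partial sums are integers, so a real bound [T] can be rounded down.  The
    index is shifted by one so that the empty partial sum is included. *)
Lemma maintains_truncn (R : realType) (n : nat) (T : R)
    (A : discarding_algorithm n) (s : sign_string n) (k : nat) :
  0 <= T -> maintains T A -> (k <= n)%N ->
  (`|\sum_(j < n | (j < k)%N && (j \notin A s)) (-1) ^+ s j : int|
     <= Num.truncn T)%N.
Proof.
case: k => [|k] T0 hA kn; first by rewrite big_pred0.
rewrite truncn_ge_nat //.
have := hA s (Ordinal kn); congr (_ <= _).
rewrite natr_absz intr_norm rmorph_sum /=; congr (`| _ |).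
by apply: eq_bigr => j _; rewrite rmorphXn /= rmorphN1.
Qed.

(** The competitor of [clipped_walk_optimal] is the shifted walk of accepted
    signs; it starts at the middle of the strip, within [Num.truncn T] of any
    [y0], which gives the additive error. *)
Lemma sum_overflow_le_discarded (R : realType) (n : nat) (T : R)
    (A : discarding_algorithm n) (s : sign_string n) (y0 : nat) :
  0 <= T -> maintains T A -> (y0 <= (Num.truncn T).*2)%N ->
  (\sum_(k < n) overflow (Num.truncn T).*2 (sign_at s k)
       (clipped_walk (Num.truncn T).*2 (sign_at s) y0 k)
   <= #|A s| + Num.truncn T)%N.
Proof.
move=> T0 hA y0M; set t := Num.truncn T in y0M *.
pose acc k := oapp (fun j => j \notin A s) false (insub k : option 'I_n).
have accE (j : 'I_n) : acc j = (j \notin A s) by rewrite /acc valK.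
pose x (k : nat) : int :=
  t%:Z + \sum_(j < n | (j < k)%N && (j \notin A s)) (-1) ^+ s j.
have x_in k : (k <= n)%N -> 0 <= x k <= t.*2%:Z.
  by move=> kn; have := maintains_truncn s T0 hA kn; rewrite /x -/t; lia.
have x_step k : (k < n)%N ->
    x k.+1 = x k + (if acc k then (-1) ^+ sign_at s k else 0).
  move=> kn; rewrite /x -addrA; congr (_ + _); set j0 := Ordinal kn.
  have -> : k = j0 by [].
  rewrite accE sign_at_ord big_mkcond (bigD1 j0) //= ltnSn addrC; congr (_ + _).
  rewrite [RHS]big_mkcond [RHS](bigD1 j0) //= ltnn add0r.
  by apply: eq_bigr => j jj0; rewrite ltnS leq_eqVlt (negbTE (jj0 : val j != val j0)).
have := clipped_walk_optimal y0M x_in x_step.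
have -> : (\sum_(k < n) ~~ acc k = #|A s|)%N.
  rewrite -sum1_card [RHS]big_mkcond; apply: eq_bigr => j _.
  by rewrite accE negbK; case: (_ \in _).
have -> : x 0%N = t%:Z by rewrite /x big_pred0 ?addr0.
by lia.
Qed.

Lemma sum_discarded_ge (R : realType) (n : nat) (T : R)
    (A : discarding_algorithm n) :
  0 <= T -> maintains T A ->
  (n * 2 ^ n <= (Num.truncn T).*2.+1 *
     (\sum_(s : sign_string n) #|A s| + 2 ^ n * Num.truncn T))%N.
Proof.
move=> T0 hA; rewrite -(sum_overflow_clipped_walk n (Num.truncn T).*2).
rewrite -[X in (_ <= X * _)%N]card_ord -sum_nat_const; apply: leq_sum => y0 _.
have -> : (2 ^ n * Num.truncn T = \sum_(s : sign_string n) Num.truncn T)%N.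
  by rewrite sum_nat_const card_ffun card_bool card_ord.
rewrite -big_split; apply: leq_sum => s _.
by apply: (sum_overflow_le_discarded s T0 hA); rewrite -ltnS.
Qed.

(** * The law of the sign string *)

Section Expectation.
Context (R : realType) (d : measure_display) (Omega : measurableType d)
  (P : probability Omega R) (n : nat) (eps : 'I_n -> {RV P >-> R}).

(** A sign string is read off from half-lines rather than from the values [1] and
    [-1], because a Rademacher variable takes these values only almost surely. *)
Lemma preimage_signs (s : sign_string n) :
  (signs eps @^-1` [set s])
  = \bigcap_(i in [set i | i \in [set: 'I_n]%SET])
      (eps i @^-1` (if s i then [set x | x < 0] else [set x | 0 <= x])).
Proof.
apply/seteqP; split=> w /=.
  by move=> <- i _ /=; rewrite ffunE; case: ltP.
move=> h; apply/ffunP => i; rewrite ffunE.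
by have := h i (finset.in_setT i); case: (s i) => /=; case: ltP.
Qed.

Lemma measurable_preimage_signs (s : sign_string n) :
  measurable (signs eps @^-1` [set s]).
Proof.
rewrite preimage_signs; apply: fin_bigcap_measurable => [|i _].
  exact: finite_finset.
rewrite -[X in measurable X]setTI; apply: measurable_funP => //.
case: (s i).
  by rewrite -set_itvNyo; exact: measurable_itv.
by rewrite -set_itvcy; exact: measurable_itv.
Qed.

(** The event that every [eps i] equals its prescribed sign has probability
    exactly [2^-n] by independence, and it is contained in the event below. *)
Lemma probability_signs_ge (s : sign_string n) :
  (forall i, rademacher (eps i)) -> mutually_independent eps ->
  (((2 ^ n)%:R^-1)%:E <= P (signs eps @^-1` [set s]))%E.
Proof.
move=> heps hindep; have := hindep [set: 'I_n]%SET (fun i => [set (-1) ^+ s i]) _.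
set E := \bigcap_(i in _) _ => PE.
have {}PE : P E = ((2 ^ n)%:R^-1)%:E.
  rewrite PE // natrX -exprVn (eq_bigr (fun=> (2^-1)%:E)).
    by rewrite prodEFin prodr_const cardsT card_ord.
  by move=> i _; have [P1 PN1] := heps i; case: (s i); rewrite ?expr1 ?expr0.
rewrite -PE; apply: le_measure; rewrite ?inE.
- apply: fin_bigcap_measurable => [|i _]; first exact: finite_finset.
  rewrite -[X in measurable X]setTI; exact: measurable_funP.
- exact: measurable_preimage_signs.
- move=> w Ew; apply/ffunP => i; rewrite ffunE (Ew i (finset.in_setT i)).
  by case: (s i); rewrite ?expr1 ?expr0 ?ltrN10 ?ltr10.
Qed.

Lemma expectation_signs (F : sign_string n -> R) : (forall s, 0 <= F s) ->
  ('E_P[fun w => F (signs eps w)]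
   = \sum_(s : sign_string n) (F s)%:E * P (signs eps @^-1` [set s]))%E.
Proof.
move=> F0; rewrite unlock.
have FE w : (F (signs eps w))%:E
    = (\sum_(s : sign_string n) (F s * \1_(signs eps @^-1` [set s]) w)%:E)%E.
  rewrite sumEFin (bigD1 (signs eps w)) //= indicE mem_set // mulr1 big1 ?addr0 //.
  by move=> s sw; rewrite indicE memNset ?mulr0 // => /esym/eqP; rewrite (negbTE sw).
under eq_integral do rewrite FE.
rewrite ge0_integral_sum //=.
- apply: eq_bigr => s _; under eq_integral do rewrite EFinM.
  rewrite ge0_integralZl ?lee_fin //.
  + by rewrite integral_indic ?setIT //; exact: measurable_preimage_signs.
  + by apply/measurable_EFinP; apply: measurable_indic; exact: measurable_preimage_signs.
- move=> s; apply/measurable_EFinP; apply: measurable_funM => //.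
  by apply: measurable_indic; exact: measurable_preimage_signs.
- by move=> s w _; rewrite lee_fin mulr_ge0.
Qed.

End Expectation.

Theorem proposition1p4 (R : realType) (d : measure_display)
    (Omega : measurableType d) (P : probability Omega R) (n : nat)
    (eps : 'I_n -> {RV P >-> R}) (T : R) (A : discarding_algorithm n)
    (hT : 0 <= T)
    (heps : forall i, rademacher (eps i))
    (hindep : mutually_independent eps)
    (hA : maintains T A) :
  ((n%:R / (2 * T + 1) - T)%:E
     <= 'E_P[fun w => #|A (signs eps w)|%:R])%E.
Proof.
rewrite (@expectation_signs _ _ _ P n eps (fun s => #|A s|%:R)) //.
pose S := (\sum_(s : sign_string n) #|A s|)%N.
apply: (@le_trans _ _ (S%:R / (2 ^ n)%:R)%:E); last first.
  rewrite natr_sum mulr_suml -sumEFin; apply: lee_sum => s _.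
  by rewrite EFinM lee_wpmul2l ?lee_fin // probability_signs_ge.
rewrite lee_fin; set t := Num.truncn T.
have tT : t%:R <= T by rewrite truncn_le.
have t0 : 0 <= t%:R :> R by [].
have N0 : 0 < (2 ^ n)%:R :> R by rewrite ltr0n expn_gt0.
have := sum_discarded_ge hT hA; rewrite -/S -/t -(ler_nat R).
have -> : (t.*2.+1 = 2 * t + 1)%N by rewrite addn1 mul2n.
rewrite !(natrM, natrD) => key.
(* Dividing the counting bound by (2t + 1) 2^n gives the claim with t for T. *)
have key' : n%:R / (2 * t%:R + 1) - t%:R <= S%:R / (2 ^ n)%:R :> R.
  rewrite lerBlDr ler_pdivrMr; last by lra.
  rewrite -(ler_pM2r N0) (le_trans key) // le_eqVlt; apply/orP; left.
  by apply/eqP; field; rewrite gt_eqF.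
(* The bound decreases in T, so t may be replaced with T. *)
apply: le_trans key'; apply: lerB => //.
by rewrite ler_wpM2l // lef_pV2 ?posrE; lra.
Qed.
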